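(* Let $\Omega=(\Sigma,\mathrm T)$ be an algebraic theory whose operations all have finite positive arities, let $\Omega\text{-}\mathbf{CMon}$ be the category of commutative $\Omega$-monoids, and let $U_\Omega\colon\Omega\text{-}\mathbf{CMon}\to\mathbf{CMon}$ be the forgetful functor to the category of commutative monoids. Let $(\mathcal T,\mathcal F)$ be a torsion theory on $\mathbf{CMon}$; let $T$ denote the coreflector into the subcategory $\mathcal T$ of torsion objects and $\tau$ the counit of the coreflection. Assume that, for all commutative $\Omega$-monoids $M$, the normal submonoid $T(U_\Omega M)\subseteq U_\Omega M$ is also a normal $\Omega$-submonoid of $M$. Then the full subcategories of $\Omega\text{-}\mathbf{CMon}$ $$\mathcal T_\Omega=\{M\mid U_\Omega M\in\mathcal T\}\quad\text{and}\quad \mathcal F_\Omega=\{M\mid U_\Omega M\in\mathcal F\}$$ form a torsion theory $(\mathcal T_\Omega,\mathcal F_\Omega)$ on $\Omega\text{-}\mathbf{CMon}$.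
   Context: An algebraic theory $\Omega=(\Sigma,\mathrm T)$ here consists of a set $\Sigma$ of operations of finite positive arities and a set $\mathrm T$ of equational axioms. A commutative $\Omega$-monoid is a commutative monoid $M$ (written additively) equipped with an $\Omega$-algebra structure such that for every $n$-ary operation $\sigma$ the function $\sigma\colon M^n\to M$ is a monoid morphism in each variable separately. Morphisms are maps that are both monoid and $\Omega$-algebra homomorphisms. A normal $\Omega$-submonoid of $M$ is an $\Omega$-submonoid $A\subseteq M$ such that: (1) for all $x,y\in M$, if $x,x+y\in A$ then $y\in A$; (2) for every $n$-ary $\sigma\in\Sigma$ and $x=(x_1,\dots,x_n)\in M^n$, $\sigma(x)\in A$ whenever some $x_i\in A$. Normal $\Omega$-submonoid inclusions are, up to isomorphism, exactly the kernels in $\Omega\text{-}\mathbf{CMon}$. A normal submonoid of a commutative monoid is a submonoid satisfying (1). A torsion theory on a pointed category is a pair $(\mathcal T,\mathcal F)$ of full replete subcategories such that every morphism $A\to B$ with $A\in\mathcal T$ and $B\in\mathcal F$ is zero, and for every object $X$ there is a short exact sequence $A\xrightarrow{k} X\xrightarrow{q} B$ ($k$ is the kernel of $q$ and $q$ the cokernel of $k$) with $A\in\mathcal T$, $B\in\mathcal F$. For such a torsion theory, $\mathcal T$ is coreflective, and the counit components $\tau_X\colon TX\to X$ are normal monomorphisms (kernels); for commutative monoids $TX$ is thus identified with a normal submonoid of $X$. *)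

(* Defs.v *)
From HB Require Import structures.
From mathcomp Require Import all_boot all_algebra.
From mathcomp Require Import boolp classical_sets.

Set Implicit Arguments.
Unset Strict Implicit.
Unset Printing Implicit Defensive.

Import GRing.Theory.

Local Open Scope classical_set_scope.
Local Open Scope ring_scope.

(** * Pointed categories and torsion theories *)

(* Morphisms are compared with Leibniz equality; comp g f is g after f. *)
Record category := Category {
  obj :> Type;
  hom : obj -> obj -> Type;
  idm : forall A, hom A A;
  comp : forall A B C, hom B C -> hom A B -> hom A C;
  comp1m : forall A B (f : hom A B), comp (idm B) f = f;
  compm1 : forall A B (f : hom A B), comp f (idm A) = f;
  compA : forall A B C D (h : hom C D) (g : hom B C) (f : hom A B),
    comp h (comp g f) = comp (comp h g) f
}.

Record pointed_category := PointedCategory {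
  pcat :> category;
  zero_obj : pcat;
  to_zero : forall A : pcat, hom A zero_obj;
  from_zero : forall A : pcat, hom zero_obj A;
  to_zero_unique : forall (A : pcat) (f : hom A zero_obj), f = to_zero A;
  from_zero_unique : forall (A : pcat) (f : hom zero_obj A), f = from_zero A
}.

Definition zero_mor (C : pointed_category) (A B : C) : hom A B :=
  comp (from_zero B) (to_zero A).

Definition isomorphic (C : category) (A B : C) : Prop :=
  exists (f : hom A B) (g : hom B A), comp g f = idm A /\ comp f g = idm B.

(* A full subcategory is given by its class of objects. *)
Definition replete (C : category) (P : C -> Prop) : Prop :=
  forall A B : C, isomorphic A B -> P A -> P B.

Definition is_kernel (C : pointed_category) (A X B : C)
    (k : hom A X) (q : hom X B) : Prop :=
  comp q k = zero_mor A B /\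
  forall (Y : C) (h : hom Y X), comp q h = zero_mor Y B ->
    exists! u : hom Y A, comp k u = h.

Definition is_cokernel (C : pointed_category) (A X B : C)
    (k : hom A X) (q : hom X B) : Prop :=
  comp q k = zero_mor A B /\
  forall (Y : C) (h : hom X Y), comp h k = zero_mor A Y ->
    exists! u : hom B Y, comp u q = h.

Definition short_exact (C : pointed_category) (A X B : C)
    (k : hom A X) (q : hom X B) : Prop :=
  is_kernel k q /\ is_cokernel k q.

Record torsion_theory (C : pointed_category) (T F : C -> Prop) : Prop :=
  TorsionTheory {
    torsion_replete : replete T;
    torsion_free_replete : replete F;
    torsion_hom0 : forall (A B : C) (f : hom A B),
      T A -> F B -> f = zero_mor A B;
    torsion_exact : forall X : C,
      exists (A B : C) (k : hom A X) (q : hom X B),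
        [/\ T A, F B & short_exact k q]
  }.

Record functor (C D : category) := Functor {
  fobj :> C -> D;
  fmap : forall A B : C, hom A B -> hom (fobj A) (fobj B);
  fmap1 : forall A : C, fmap (idm A) = idm (fobj A);
  fmapM : forall (X Y Z : C) (g : hom Y Z) (f : hom X Y),
    fmap (comp g f) = comp (fmap g) (fmap f)
}.

(* The coreflector is a right adjoint to the inclusion of the full subcategory
   P, presented as an endofunctor of C with values in P; the last two fields
   say that its counit is natural and universal. *)
Record coreflection (C : category) (P : C -> Prop) := Coreflection {
  coreflector :> functor C C;
  coreflector_in : forall X : C, P (coreflector X);
  counit : forall X : C, hom (coreflector X) X;
  counit_natural : forall (X Y : C) (f : hom X Y),
    comp (counit Y) (fmap coreflector f) = comp f (counit X);
  counit_universal : forall (A X : C) (f : hom A X), P A ->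
    exists! g : hom A (coreflector X), comp (counit X) g = f
}.

(** * The category of commutative monoids *)

Lemma additive_ext (A B : nmodType) (f g : {additive A -> B}) : f =1 g -> f = g.
Proof.
case: f g => [f [[fP]]] [g [[gP]]] /= /funext efg.
by subst g; rewrite (Prop_irrelevance fP gP).
Qed.

Definition CMon_category : category.
Proof.
refine (@Category nmodType (fun A B => {additive A -> B})
  (fun A => idfun : {additive A -> A})
  (fun A B C g f => g \o f : {additive A -> C}) _ _ _) => *;
  exact: additive_ext.
Defined.

Definition CMon : pointed_category.
Proof.
refine (@PointedCategory CMon_category ('I_1 : nmodType)
  (fun A : nmodType => \0 : {additive A -> 'I_1})
  (fun A : nmodType => \0 : {additive 'I_1 -> A}) _ _).
- by move=> A f; apply: additive_ext => x; rewrite !ord1.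
- by move=> A f; apply: additive_ext => x; rewrite (ord1 x) !raddf0.
Defined.

(** * Algebraic theories and commutative Omega-monoids *)

Inductive term (S : Type) (ar : S -> nat) : Type :=
| Var of nat
| App (s : S) of ('I_(ar s) -> term ar).

Arguments Var {S ar}.
Arguments App {S ar}.

Record algebraic_theory := AlgebraicTheory {
  opsym : Type;
  arity : opsym -> nat;
  arity_gt0 : forall s, (0 < arity s)%N;
  axioms : set (term arity * term arity)
}.

Fixpoint eval (S : Type) (ar : S -> nat) (M : Type)
    (op : forall s, {ffun 'I_(ar s) -> M} -> M) (e : nat -> M)
    (t : term ar) : M :=
  match t with
  | Var n => e n
  | App s a => op s [ffun i => eval op e (a i)]
  end.

Definition update (n : nat) (M : Type) (x : {ffun 'I_n -> M}) (i : 'I_n)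
    (a : M) : {ffun 'I_n -> M} :=
  [ffun j => if j == i then a else x j].

Record omega_monoid (Om : algebraic_theory) := OmegaMonoid {
  omon :> nmodType;
  op : forall s : opsym Om, {ffun 'I_(arity s) -> omon} -> omon;
  op_additive : forall (s : opsym Om) (x : {ffun 'I_(arity s) -> omon})
    (i : 'I_(arity s)), nmod_morphism (fun a => op (update x i a));
  op_axioms : forall t : term (@arity Om) * term (@arity Om), axioms t ->
    forall e : nat -> omon, eval op e t.1 = eval op e t.2
}.

Record omega_hom (Om : algebraic_theory) (M N : omega_monoid Om) := OmegaHom {
  omap :> {additive M -> N};
  omap_op : forall (s : opsym Om) (x : {ffun 'I_(arity s) -> M}),
    omap (op x) = op [ffun i => omap (x i)]
}.

Lemma omega_hom_ext (Om : algebraic_theory) (M N : omega_monoid Om)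
  (f g : omega_hom M N) : f =1 g -> f = g.
Proof.
case: f g => [f fP] [g gP] /= /additive_ext efg.
by subst g; rewrite (Prop_irrelevance fP gP).
Qed.

Section OmegaCMon.
Variable Om : algebraic_theory.

Definition omega_id (M : omega_monoid Om) : omega_hom M M.
Proof.
refine (@OmegaHom Om M M idfun _) => s x /=.
by congr op; apply/ffunP => i; rewrite ffunE.
Defined.

Definition omega_comp (M N P : omega_monoid Om) (g : omega_hom N P)
  (f : omega_hom M N) : omega_hom M P.
Proof.
refine (@OmegaHom Om M P (g \o f) _) => s x /=.
by rewrite !omap_op; congr op; apply/ffunP => i; rewrite !ffunE.
Defined.

Definition omega_zero : omega_monoid Om.
Proof.
refine (@OmegaMonoid Om ('I_1 : nmodType) (fun s _ => 0) _ _).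
- by move=> s x i; split=> [|a b] //=; rewrite addr0.
- by move=> t _ e; rewrite (ord1 (eval _ _ t.1)) (ord1 (eval _ _ t.2)).
Defined.

Lemma op0 (M : omega_monoid Om) (s : opsym Om) :
  op [ffun _ : 'I_(arity s) => 0] = 0 :> M.
Proof.
pose i := Ordinal (arity_gt0 s); pose z : {ffun 'I_(arity s) -> M} := [ffun=> 0].
rewrite -[RHS](op_additive z i).1; congr op.
by apply/ffunP => j; rewrite !ffunE; case: ifP.
Qed.

Definition omega_to_zero (M : omega_monoid Om) : omega_hom M omega_zero.
Proof.
by refine (@OmegaHom Om M omega_zero \0 _).
Defined.

Definition omega_from_zero (M : omega_monoid Om) : omega_hom omega_zero M.
Proof.
refine (@OmegaHom Om omega_zero M \0 _) => s x /=.
by rewrite -[LHS](op0 M s); congr op; apply/ffunP => i; rewrite !ffunE.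
Defined.

Definition OmegaCMon_category : category.
Proof.
refine (@Category (omega_monoid Om) (@omega_hom Om) omega_id omega_comp
  _ _ _) => *; exact: omega_hom_ext.
Defined.

Definition OmegaCMon : pointed_category.
Proof.
refine (@PointedCategory OmegaCMon_category omega_zero omega_to_zero
  omega_from_zero _ _).
- by move=> A f; apply: omega_hom_ext => x; rewrite [LHS]ord1 [RHS]ord1.
- by move=> A f; apply: omega_hom_ext => x; rewrite (ord1 x) !raddf0.
Defined.

Definition forget : functor OmegaCMon CMon :=
  @Functor OmegaCMon CMon (fun M : omega_monoid Om => omon M)
    (fun M N (f : omega_hom M N) => omap f)
    (fun _ => erefl) (fun _ _ _ _ _ => erefl).

Definition omega_submonoid (M : omega_monoid Om) (A : set M) : Prop :=
  [/\ A 0,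
      forall x y, A x -> A y -> A (x + y) &
      forall (s : opsym Om) (x : {ffun 'I_(arity s) -> M}),
        (forall i, A (x i)) -> A (op x)].

Definition normal_omega_submonoid (M : omega_monoid Om) (A : set M) : Prop :=
  [/\ omega_submonoid A,
      forall x y, A x -> A (x + y) -> A y &
      forall (s : opsym Om) (x : {ffun 'I_(arity s) -> M}),
        (exists i, A (x i)) -> A (op x)].

End OmegaCMon.

(* The submonoid of B represented by a monomorphism f : A -> B of CMon. *)
Definition subobject (A B : CMon) (f : hom A B) : set (B : nmodType) :=
  range (f : {additive (A : nmodType) -> (B : nmodType)}).

(* Main.v *)
From HB Require Import structures.
From mathcomp Require Import all_boot all_algebra.
From mathcomp Require Import boolp classical_sets.
Require Import Defs.

(** Let [k : A -> X], [q : X -> B] be the short exact sequence that the torsion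
    theory on commutative monoids attaches to [X = U M].  The idea is that [A]
    and [B] themselves already carry the structures of commutative
    Omega-monoids, so the same sequence witnesses the claim for [M].

    The image of the coreflection counit [T X -> X] is the image of [k], namely
    the kernel of [q]: every morphism from a torsion object to [X] factors
    through the counit, and it also factors through [k], being killed by [q]
    (range_counit).  The hypothesis therefore says that the operations of [M]
    send a tuple with one coordinate in [k A] into [k A].

    Since [k] is a kernel it is injective, and as arities are positive its image
    is closed under the operations, so [A] inherits them
    (section SubOmegaMonoid).  Since [q] is a cokernel of [k], it is the
    quotient of [X] by the congruence relating [x] and [y] when
    [x + k a = y + k b] for some [a] and [b] (cokernel_surj, cokernel_fiber);
    multilinearity and absorption make this congruence compatible with the
    operations, one coordinate at a time (absorbing_congr), so [B] inherits
    them too (section QuotientOmegaMonoid).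

    Lastly, the factorizations through [k] and [q] that exist in commutative
    monoids respect the operations, because [k] is injective and [q] is
    surjective; hence exactness lifts (short_exact_lift).  Orthogonality and
    repleteness only need that the forgetful functor is a faithful functor that
    preserves zero morphisms. *)

Set Implicit Arguments.
Unset Strict Implicit.
Unset Printing Implicit Defensive.

Import GRing.Theory.

Local Open Scope classical_set_scope.
Local Open Scope ring_scope.
Local Open Scope quotient_scope.

(** * Kernels of commutative monoids *)

Section Multiples.
Variables (X : nmodType) (x : X).

(** The morphism from the free commutative monoid on one generator that sends
    the generator to [x]. *)
Definition multiples (n : nat) : X := x *+ n.

Fact multiples_is_nmod_morphism : nmod_morphism multiples.
Proof. by split=> [|m n]; [exact: mulr0n | exact: mulrnDr]. Qed.

HB.instance Definition _ :=
  GRing.isNmodMorphism.Build nat X multiples multiples_is_nmod_morphism.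

End Multiples.

Section Kernel.
Variables (A X B : nmodType) (k : {additive A -> X}) (q : {additive X -> B}).
Hypothesis kerkq : @is_kernel CMon A X B k q.

Lemma kernel_comp0 a : q (k a) = 0.
Proof.
exact: (congr1 (fun f : {additive A -> B} => f a) kerkq.1).
Qed.

Lemma kernel_factor (Y : nmodType) (h : {additive Y -> X}) :
  (forall y, q (h y) = 0) ->
  exists2 u : {additive Y -> A}, forall y, k (u y) = h y &
    forall v : {additive Y -> A}, (forall y, k (v y) = h y) -> u = v.
Proof.
move=> qh.
have [|u [ku uuniq]] := kerkq.2 Y h; first exact: additive_ext.
exists u => [y|v kv]; last by apply: uuniq; exact: additive_ext.
exact: (congr1 (fun f : {additive Y -> X} => f y) ku).
Qed.

(** Elements are detected by morphisms out of the free monoid [nat], so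
    cancellability of [k] on such morphisms gives injectivity. *)
Lemma kernel_inj : injective k.
Proof.
move=> a b kab.
have [|u _ uuniq] := @kernel_factor nat (multiples (k a)).
  by move=> n; rewrite /= /multiples raddfMn /= kernel_comp0 mul0rn.
have factor c : k c = k a -> u = multiples c.
  by move=> kc; apply: uuniq => n; rewrite /= /multiples raddfMn /= kc.
have := factor a erefl; rewrite (factor b (esym kab)).
by move/(congr1 (fun f : {additive nat -> A} => f 1%N)).
Qed.

Lemma kernel_range : range k = [set x | q x = 0].
Proof.
apply/seteqP; split=> [_ [a _ <-]|x /= qx]; first exact: kernel_comp0.
have [|u ku _] := @kernel_factor nat (multiples x).
  by move=> n; rewrite /= /multiples raddfMn /= qx mul0rn.
by exists (u 1%N) => //; rewrite ku.
Qed.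

End Kernel.

(** * Cokernels of commutative monoids *)

Section CokernelQuotient.
Variables (A X : nmodType) (k : {additive A -> X}).

Definition cokernel_rel (x y : X) : bool :=
  `[< exists a b, x + k a = y + k b >].

Fact cokernel_rel_equiv : equiv_class_of cokernel_rel.
Proof.
split=> [x|x y|y x z].
- by apply/asboolP; exists 0, 0.
- by apply/asboolP/asboolP => -[a [b e]]; exists b, a.
- move=> /asboolP[a [b e]] /asboolP[c [d e']]; apply/asboolP.
  exists (a + c), (d + b).
  by rewrite !raddfD addrA e addrAC e' addrA.
Qed.

Canonical cokernel_equiv := EquivRelPack cokernel_rel_equiv.

Definition coker := {eq_quot cokernel_equiv}.

HB.instance Definition _ := Choice.on coker.
HB.instance Definition _ := EqQuotient.on coker.

Lemma eq_coker (x y : X) :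
  \pi_coker x = \pi_coker y <-> exists a b, x + k a = y + k b.
Proof.
split=> [/eqP|e]; first by rewrite eqmodE => /asboolP.
by apply/eqP; rewrite eqmodE; apply/asboolP.
Qed.

Definition coker_add (c d : coker) : coker := \pi_coker (repr c + repr d).

Lemma pi_coker_add x y :
  \pi_coker (x + y) = coker_add (\pi_coker x) (\pi_coker y).
Proof.
have /eq_coker[a [b ex]] := esym (reprK (\pi_coker x)).
have /eq_coker[c [d ey]] := esym (reprK (\pi_coker y)).
apply/eq_coker; exists (a + c), (b + d).
by rewrite !raddfD addrACA ex ey addrACA.
Qed.

Fact pi_coker_surj (c : coker) : exists x, c = \pi_coker x.
Proof. by exists (repr c); rewrite reprK. Qed.

Fact coker_addA : associative coker_add.
Proof.
move=> c d e; have [x ->] := pi_coker_surj c.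
have [y ->] := pi_coker_surj d; have [z ->] := pi_coker_surj e.
by rewrite -!pi_coker_add addrA.
Qed.

Fact coker_addC : commutative coker_add.
Proof.
move=> c d; have [x ->] := pi_coker_surj c; have [y ->] := pi_coker_surj d.
by rewrite -!pi_coker_add addrC.
Qed.

Fact coker_add0 : left_id (\pi_coker 0) coker_add.
Proof.
by move=> c; have [x ->] := pi_coker_surj c; rewrite -pi_coker_add add0r.
Qed.

HB.instance Definition _ :=
  GRing.isNmodule.Build coker coker_addA coker_addC coker_add0.

Definition coker_pi (x : X) : coker := \pi_coker x.

Fact coker_pi_is_nmod_morphism : nmod_morphism coker_pi.
Proof. by split=> // x y; exact: pi_coker_add. Qed.

HB.instance Definition _ :=
  GRing.isNmodMorphism.Build X coker coker_pi coker_pi_is_nmod_morphism.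

Lemma coker_pi_comp0 a : coker_pi (k a) = 0.
Proof. by apply/eq_coker; exists 0, a; rewrite raddf0 addr0 add0r. Qed.

End CokernelQuotient.

Section Cokernel.
Variables (A X B : nmodType) (k : {additive A -> X}) (q : {additive X -> B}).
Hypothesis cokerkq : @is_cokernel CMon A X B k q.

Lemma cokernel_comp0 a : q (k a) = 0.
Proof.
exact: (congr1 (fun f : {additive A -> B} => f a) cokerkq.1).
Qed.

Lemma cokernel_factor (Y : nmodType) (h : {additive X -> Y}) :
  (forall a, h (k a) = 0) ->
  exists2 u : {additive B -> Y}, forall x, u (q x) = h x &
    forall v : {additive B -> Y}, (forall x, v (q x) = h x) -> u = v.
Proof.
move=> hk.
have [|u [uq uuniq]] := cokerkq.2 Y h; first exact: additive_ext.
exists u => [x|v vq]; last by apply: uuniq; exact: additive_ext.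
exact: (congr1 (fun f : {additive X -> Y} => f x) uq).
Qed.

Lemma cokernel_fiber x y : q x = q y <-> exists a b, x + k a = y + k b.
Proof.
split=> [qxy|[a [b /(congr1 q)]]]; last first.
  by rewrite !raddfD /= !cokernel_comp0 !addr0.
have [u uq _] := cokernel_factor (@coker_pi_comp0 A X k).
by apply/(@eq_coker _ _ k); have := uq x; rewrite qxy uq.
Qed.

Definition coker_desc (c : coker k) : B := q (repr c).

Lemma coker_descE x : coker_desc (coker_pi k x) = q x.
Proof. by apply/cokernel_fiber/(@eq_coker _ _ k); rewrite reprK. Qed.

Fact coker_desc_is_nmod_morphism : nmod_morphism coker_desc.
Proof.
split=> [|]; first by rewrite -(raddf0 (coker_pi k)) coker_descE raddf0.
move=> c d; have [x ->] := pi_coker_surj c; have [y ->] := pi_coker_surj d.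
by rewrite -!/(coker_pi k _) -raddfD !coker_descE raddfD.
Qed.

HB.instance Definition _ :=
  GRing.isNmodMorphism.Build (coker k) B coker_desc coker_desc_is_nmod_morphism.

(** Epimorphisms of commutative monoids need not be surjective; a cokernel is,
    because the comparison map from the concrete quotient, whose image is that
    of [q], has a section. *)
Lemma cokernel_surj b : exists x, q x = b.
Proof.
have [u uq _] := cokernel_factor (@coker_pi_comp0 A X k).
have [w _ wuniq] := cokernel_factor cokernel_comp0.
have wid : w = idfun by exact: wuniq.
have wdesc : w = (coker_desc \o u : {additive B -> B}).
  by apply: wuniq => x /=; rewrite uq coker_descE.
exists (repr (u b)).
by have := congr1 (fun f : {additive B -> B} => f b) (etrans (esym wdesc) wid).
Qed.

End Cokernel.

(** * Transport of operations along injections and surjections *)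

Lemma eval_morph (S : Type) (ar : S -> nat) (M N : Type)
    (opM : forall s, {ffun 'I_(ar s) -> M} -> M)
    (opN : forall s, {ffun 'I_(ar s) -> N} -> N) (f : M -> N) :
  (forall s x, f (opM s x) = opN s [ffun i => f (x i)]) ->
  forall (e : nat -> M) (t : term ar),
    f (eval opM e t) = eval opN (f \o e) t.
Proof.
move=> fop e; elim=> [//|s a IH] /=.
by rewrite fop; congr (opN s); apply/ffunP => i; rewrite !ffunE IH.
Qed.

Lemma map_update (n : nat) (M N : Type) (f : M -> N) (x : {ffun 'I_n -> M})
    (i : 'I_n) (a : M) :
  [ffun j => f (update x i a j)] = update [ffun j => f (x j)] i (f a).
Proof. by apply/ffunP => j; rewrite !ffunE; case: ifP. Qed.

Section SubOmegaMonoid.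
Variables (Om : algebraic_theory) (M : omega_monoid Om).
Variables (A : nmodType) (k : {additive A -> M}).
Hypothesis k_inj : injective k.
Hypothesis k_closed : forall (s : opsym Om) (x : {ffun 'I_(arity s) -> A}),
  exists a, k a = op [ffun i => k (x i)].

Definition sub_op (s : opsym Om) (x : {ffun 'I_(arity s) -> A}) : A :=
  sval (cid (k_closed x)).

Lemma sub_opE s (x : {ffun 'I_(arity s) -> A}) :
  k (sub_op x) = op [ffun i => k (x i)].
Proof. exact: svalP (cid (k_closed x)). Qed.

Fact sub_op_additive (s : opsym Om) (x : {ffun 'I_(arity s) -> A})
    (i : 'I_(arity s)) : nmod_morphism (fun a => sub_op (update x i a)).
Proof.
have [op0 opD] := op_additive [ffun j => k (x j)] i.
split=> [|a b]; apply: k_inj; rewrite ?raddfD !sub_opE !map_update.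
  by rewrite raddf0.
by rewrite raddfD; exact: opD.
Qed.

Fact sub_op_axioms (t : term (@arity Om) * term (@arity Om)) : axioms t ->
  forall e : nat -> A, eval sub_op e t.1 = eval sub_op e t.2.
Proof.
move=> tax e; apply: k_inj.
by rewrite !(eval_morph (opN := @op Om M) sub_opE); exact: op_axioms.
Qed.

Definition sub_omega : omega_monoid Om :=
  OmegaMonoid sub_op_additive sub_op_axioms.

Definition sub_omega_hom : omega_hom sub_omega M :=
  @OmegaHom Om sub_omega M k sub_opE.

End SubOmegaMonoid.

Section QuotientOmegaMonoid.
Variables (Om : algebraic_theory) (M : omega_monoid Om).
Variables (B : nmodType) (q : {additive M -> B}).
Hypothesis q_surj : forall b, exists x, q x = b.
Hypothesis q_congr : forall (s : opsym Om) (x y : {ffun 'I_(arity s) -> M}),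
  (forall i, q (x i) = q (y i)) -> q (op x) = q (op y).

Definition quo_lift (b : B) : M := sval (cid (q_surj b)).

Lemma quo_liftK : cancel quo_lift q.
Proof. by move=> b; exact: svalP (cid (q_surj b)). Qed.

Definition quo_op (s : opsym Om) (x : {ffun 'I_(arity s) -> B}) : B :=
  q (op [ffun i => quo_lift (x i)]).

Lemma quo_opE s (x : {ffun 'I_(arity s) -> M}) :
  q (op x) = quo_op [ffun i => q (x i)].
Proof. by apply: q_congr => i; rewrite !ffunE quo_liftK. Qed.

Fact quo_op_additive (s : opsym Om) (x : {ffun 'I_(arity s) -> B})
    (i : 'I_(arity s)) : nmod_morphism (fun b => quo_op (update x i b)).
Proof.
pose y := [ffun j => quo_lift (x j)].
have quoE a : quo_op (update x i (q a)) = q (op (update y i a)).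
  rewrite quo_opE map_update; congr (quo_op (update _ i _)).
  by apply/ffunP => j; rewrite !ffunE quo_liftK.
have [op0 opD] := op_additive y i.
split=> [|a b]; first by rewrite -(raddf0 q) quoE op0 raddf0.
by rewrite -(quo_liftK a) -(quo_liftK b) -raddfD !quoE opD raddfD.
Qed.

Fact quo_op_axioms (t : term (@arity Om) * term (@arity Om)) : axioms t ->
  forall e : nat -> B, eval quo_op e t.1 = eval quo_op e t.2.
Proof.
move=> tax e.
have -> : e = q \o (quo_lift \o e) by apply/funext => n /=; rewrite quo_liftK.
by rewrite -!(eval_morph (opM := @op Om M) quo_opE) (op_axioms tax).
Qed.

Definition quo_omega : omega_monoid Om :=
  OmegaMonoid quo_op_additive quo_op_axioms.

Definition quo_omega_hom : omega_hom M quo_omega :=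
  @OmegaHom Om M quo_omega q quo_opE.

End QuotientOmegaMonoid.

(** A congruence for addition whose zero class absorbs the operations is a
    congruence for the operations: replacing the [i]-th argument [x i] by
    [x i + a] with [a] in the zero class adds, by multilinearity, an element of
    the zero class to the result.  All arguments are then replaced in turn. *)
Lemma absorbing_congr (Om : algebraic_theory) (M : omega_monoid Om)
    (A B : nmodType) (k : {additive A -> M}) (q : {additive M -> B}) :
  (forall x y, q x = q y <-> exists a b, x + k a = y + k b) ->
  (forall (s : opsym Om) (x : {ffun 'I_(arity s) -> M}),
     (exists i, range k (x i)) -> q (op x) = 0) ->
  forall (s : opsym Om) (x y : {ffun 'I_(arity s) -> M}),
    (forall i, q (x i) = q (y i)) -> q (op x) = q (op y).
Proof.
move=> fiber absorb s x y qxy.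
have op_addk (z : {ffun 'I_(arity s) -> M}) i c a :
    q (op (update z i (c + k a))) = q (op (update z i c)).
  rewrite (op_additive z i).2 raddfD [X in _ + X]absorb ?addr0 //.
  by exists i; rewrite ffunE eqxx; exists a.
(* the first m arguments have been replaced *)
pose z m := [ffun j : 'I_(arity s) => if (j < m)%N then y j else x j].
suff qz m : (m <= arity s)%N -> q (op (z m)) = q (op x).
  rewrite -(qz _ (leqnn _)); congr (q (op _)).
  by apply/ffunP => j; rewrite ffunE ltn_ord.
elim: m => [_|m IH lt_m].
  by congr (q (op _)); apply/ffunP => j; rewrite ffunE.
rewrite -IH ?(ltnW lt_m) //; pose i := Ordinal lt_m.
have -> : z m.+1 = update (z m) i (y i).
  apply/ffunP => j; rewrite !ffunE ltnS leq_eqVlt -val_eqE /=.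
  by case: eqP => //= e; congr (y _); exact: val_inj.
have -> : z m = update (z m) i (x i).
  apply/ffunP => j; rewrite !ffunE -val_eqE /=.
  by case: eqP => //= e; rewrite e ltnn; congr (x _); exact: val_inj.
have /fiber[a [b e]] := qxy i.
have upd2 c : update (update (z m) i (x i)) i c = update (z m) i c.
  by apply/ffunP => j; rewrite !ffunE; case: (j == i).
by rewrite upd2 -(op_addk _ _ (y i) b) -e op_addk.
Qed.

(** * Lifting exactness and torsion theories *)

(** The forgetful functor is faithful, so only the compatibility with the
    operations of the factorizations given by exactness is at stake: it can be
    tested after composing with the injection [k], and before composing with
    the surjection [q]. *)
Lemma short_exact_lift (Om : algebraic_theory) (A M B : omega_monoid Om)
    (k : omega_hom A M) (q : omega_hom M B) :
  @short_exact CMon A M B (omap k) (omap q) ->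
  @short_exact (OmegaCMon Om) A M B k q.
Proof.
move=> [kerkq cokerkq].
have qk : comp (q : @hom (OmegaCMon Om) M B) k = zero_mor _ _.
  by apply: omega_hom_ext => a; exact: (kernel_comp0 kerkq).
split; split=> // Y h.
- move=> qh.
  have [|u ku uuniq] := @kernel_factor _ _ _ _ _ kerkq _ (omap h).
    by move=> y; exact: (congr1 (fun f : omega_hom Y B => f y) qh).
  have u_op s (x : {ffun 'I_(arity s) -> Y}) :
      u (op x) = op [ffun i => u (x i)].
    apply: (kernel_inj kerkq); rewrite ku !omap_op; congr op.
    by apply/ffunP => i; rewrite !ffunE ku.
  exists (@OmegaHom Om Y A u u_op); split; first exact: omega_hom_ext.
  move=> v kv; apply: omega_hom_ext => y /=.
  rewrite (uuniq (omap v)) // => z.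
  exact: (congr1 (fun f : omega_hom Y M => f z) kv).
- move=> hk.
  have [|u uq uuniq] := @cokernel_factor _ _ _ _ _ cokerkq _ (omap h).
    by move=> a; exact: (congr1 (fun f : omega_hom A Y => f a) hk).
  have u_op s (x : {ffun 'I_(arity s) -> B}) :
      u (op x) = op [ffun i => u (x i)].
    pose y := [ffun i => sval (cid (cokernel_surj cokerkq (x i)))].
    have -> : x = [ffun i => q (y i)].
      apply/ffunP => i; rewrite !ffunE.
      by rewrite (svalP (cid (cokernel_surj cokerkq (x i)))).
    rewrite -omap_op uq omap_op; congr op.
    by apply/ffunP => i; rewrite !ffunE uq.
  exists (@OmegaHom Om B Y u u_op); split; first exact: omega_hom_ext.
  move=> v vq; apply: omega_hom_ext => b /=.
  rewrite (uuniq (omap v)) // => x.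
  exact: (congr1 (fun f : omega_hom M Y => f x) vq).
Qed.

(** Both sides are the largest torsion subobject: the counit is killed by [q]
    since its source is torsion and [B] is torsion-free, and [k] factors
    through the counit since [A] is torsion. *)
Lemma range_counit (TT FF : CMon -> Prop) (tors : torsion_theory TT FF)
    (T : coreflection TT) (A X B : nmodType)
    (k : {additive A -> X}) (q : {additive X -> B}) :
  TT A -> FF B -> @is_kernel CMon A X B k q ->
  @subobject (T X) X (counit T X) = range k.
Proof.
move=> TA FB kerkq; apply/seteqP; split=> [_ [t _ <-]|_ [a _ <-]].
- rewrite (kernel_range kerkq) /=.
  have := torsion_hom0 tors (@comp CMon (T X) X B q (counit T X))
    (coreflector_in T X) FB.
  exact: (congr1 (fun f : {additive (T X : nmodType) -> B} => f t)).
- have [g [cg _]] := counit_universal T (k : @hom CMon A X) TA.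
  exists ((g : {additive A -> (T X : nmodType)}) a) => //.
  exact: (congr1 (fun f : {additive A -> X} => f a) cg).
Qed.

Lemma functor_isomorphic (C D : category) (G : functor C D) (A B : C) :
  isomorphic A B -> isomorphic (G A) (G B).
Proof.
move=> [f [g [gf fg]]]; exists (fmap G f), (fmap G g).
by rewrite -!fmapM gf fg !fmap1.
Qed.

Theorem proposition7p2 (Om : algebraic_theory) (TT FF : CMon -> Prop)
    (tors : torsion_theory TT FF) (T : coreflection TT)
    (normalT : forall M : OmegaCMon Om,
       normal_omega_submonoid (subobject (counit T (forget Om M)))) :
  torsion_theory (C := OmegaCMon Om)
    (fun M => TT (forget Om M)) (fun M => FF (forget Om M)).
Proof.
split.
- move=> M N /(functor_isomorphic (forget Om)); exact: (torsion_replete tors).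
- move=> M N /(functor_isomorphic (forget Om)).
  exact: (torsion_free_replete tors).
- move=> M N f TM FN; apply: omega_hom_ext => x.
  have := torsion_hom0 tors (fmap (forget Om) f) TM FN.
  by move/(congr1 (fun g : {additive omon M -> omon N} => g x)).
- move=> M.
  have [A [B [k [q [TA FB ex]]]]] := torsion_exact tors (forget Om M).
  have [kerkq cokerkq] := ex.
  have [_ _ absorb] := normalT M.
  rewrite (range_counit tors T TA FB kerkq) in absorb.
  have k_closed (s : opsym Om) (x : {ffun 'I_(arity s) -> (A : nmodType)}) :
      exists a, k a = op [ffun i => k (x i)].
    (* the first coordinate exists because arities are positive *)
    have /absorb[a _ ka] : exists i, range k ([ffun i => k (x i)] i).
      pose i := Ordinal (arity_gt0 s).
      by exists i; rewrite ffunE; exists (x i).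
    by exists a.
  have q_absorb (s : opsym Om) (x : {ffun 'I_(arity s) -> omon M}) :
      (exists i, range k (x i)) -> q (op x) = 0.
    by move=> /absorb; rewrite (kernel_range kerkq).
  have q_congr := absorbing_congr (cokernel_fiber cokerkq) q_absorb.
  have q_surj := cokernel_surj cokerkq.
  exists (sub_omega (kernel_inj kerkq) k_closed), (quo_omega q_surj q_congr).
  exists (sub_omega_hom (kernel_inj kerkq) k_closed).
  exists (quo_omega_hom q_surj q_congr).
  by split=> //; exact: short_exact_lift.
Qed.
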